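(* Either $\liminf_{n\to\infty}\operatorname{Var}(S_n)/n^2>0$, or $\operatorname{Var}(S_n)/n^2\to0$ as $n\to\infty$.
   Context: Let $X_1,X_2,\ldots$ be a sequence of centred, weakly stationary, real random variables with finite second moments, and $S_n=X_1+\cdots+X_n$. *)

(* Defs.v *)
(* No measure/probability library is installed,
   so a probability space is modelled abstractly by its expectation functional
   (a normalized, monotone, linear functional on a vector space of integrable
   real random variables). *)
From Stdlib Require Import Reals.
Open Scope R_scope.

Record ExpSpace := {
  Omega : Type;
  integrable : (Omega -> R) -> Prop;
  E : (Omega -> R) -> R;
  integrable_const : forall c : R, integrable (fun _ => c);
  integrable_plus : forall f g, integrable f -> integrable g ->
      integrable (fun w => f w + g w);
  integrable_scal : forall (c : R) f, integrable f -> integrable (fun w => c * f w);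
  E_plus : forall f g, integrable f -> integrable g ->
      E (fun w => f w + g w) = E f + E g;
  E_scal : forall (c : R) f, integrable f -> E (fun w => c * f w) = c * E f;
  E_mono : forall f g, integrable f -> integrable g ->
      (forall w, f w <= g w) -> E f <= E g;
  E_one : E (fun _ => 1) = 1
}.

Definition Var (P : ExpSpace) (f : Omega P -> R) : R :=
  E P (fun w => f w * f w) - E P f * E P f.

(* Partial sums: Ssum X n = X 0 + ... + X (n-1)  (paper's S_n = X_1+...+X_n,
   with the paper's X_{i+1} written X i here). *)
Fixpoint Ssum {T : Type} (X : nat -> T -> R) (n : nat) (w : T) : R :=
  match n with
  | O => 0
  | S m => Ssum X m w + X m w
  end.

(* Main.v *)
(* Write a_n = E[S_n^2] (= Var(S_n), the X_i being centred).  Cutting X_0 + ... +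
   X_(n-1) into the n overlapping windows of length m gives, pointwise,
       m S_n = sum_(k<n) W_k - sum_(j<m) (U_j - S_j),
   where W_k = X_k + ... + X_(k+m-1) and U_j = X_n + ... + X_(n+j-1).  Two uses of
   Cauchy-Schwarz and stationarity (every window has second moment a_m) yield
       m^2 a_n <= 2 n^2 a_m + 8 m (a_0 + ... + a_(m-1)).
   Hence a single m with a_m/m^2 small makes a_n/n^2 small for all large n. *)
Require Import Defs.
From Stdlib Require Import Reals Lra Lia Psatz Classical FunctionalExtensionality.
Open Scope R_scope.

Section PartialSums.
Context {T : Type}.
Implicit Types (F G : nat -> T -> R) (w : T).

Lemma Ssum_ext F G n w :
  (forall k, F k w = G k w) -> Ssum F n w = Ssum G n w.
Proof. intros H; induction n as [|n IH]; simpl; [reflexivity|]; rewrite IH, H; reflexivity. Qed.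

Lemma Ssum_le F G n w :
  (forall k, F k w <= G k w) -> Ssum F n w <= Ssum G n w.
Proof. intros H; induction n as [|n IH]; simpl; [lra|]. specialize (H n); lra. Qed.

Lemma Ssum_plus F G n w :
  Ssum (fun k w => F k w + G k w) n w = Ssum F n w + Ssum G n w.
Proof. induction n as [|n IH]; simpl; [ring|]; rewrite IH; ring. Qed.

Lemma Ssum_const (c : T -> R) n w : Ssum (fun _ => c) n w = INR n * c w.
Proof. induction n as [|n IH]; simpl Ssum; [simpl; ring|]; rewrite IH, S_INR; ring. Qed.

Lemma Ssum_mul_r F (g : T -> R) n w :
  Ssum F n w * g w = Ssum (fun k w => F k w * g w) n w.
Proof. induction n as [|n IH]; simpl; [ring|]; rewrite <- IH; ring. Qed.

Lemma Ssum_mul_l (f : T -> R) G n w :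
  f w * Ssum G n w = Ssum (fun k w => f w * G k w) n w.
Proof. induction n as [|n IH]; simpl; [ring|]; rewrite <- IH; ring. Qed.

Lemma Ssum_prod F G a b w :
  Ssum F a w * Ssum G b w = Ssum (fun i w => Ssum (fun j w => F i w * G j w) b w) a w.
Proof.
  rewrite Ssum_mul_r. apply Ssum_ext; intros i. apply Ssum_mul_l.
Qed.

Lemma Ssum_split F a b w :
  Ssum F (a + b) w = Ssum F a w + Ssum (fun k => F (a + k)%nat) b w.
Proof.
  induction b as [|b IH]; simpl.
  - rewrite Nat.add_0_r; ring.
  - rewrite Nat.add_succ_r; simpl; rewrite IH; ring.
Qed.

Lemma Ssum_swap (H : nat -> nat -> T -> R) n m w :
  Ssum (fun k w => Ssum (H k) m w) n w = Ssum (fun j w => Ssum (fun k => H k j) n w) m w.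
Proof.
  induction n as [|n IH]; simpl.
  - rewrite Ssum_const; ring.
  - rewrite IH, <- Ssum_plus. reflexivity.
Qed.

Lemma Ssum_sq_nonneg F n w : 0 <= Ssum (fun k w => F k w * F k w) n w.
Proof.
  rewrite <- (Rmult_0_r (INR n)), <- (Ssum_const (fun _ => 0) n w).
  apply Ssum_le; intros k; apply Rle_0_sqr.
Qed.

Lemma cauchy_schwarz_step (n t s a : R) : 0 <= n -> 0 <= t -> s * s <= n * t ->
  (s + a) * (s + a) <= (n + 1) * (t + a * a).
Proof.
  intros Hn Ht Hst.
  (* The increment t + n a^2 - 2 s a is nonnegative: multiplied by t it is at least
     (t - s a)^2, since n t >= s^2. *)
  assert (HQ : 0 <= t + n * (a * a) - 2 * s * a).
  { destruct (Rle_lt_or_eq_dec 0 t Ht) as [Htpos | <-].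
    - apply Rmult_le_reg_l with t; [exact Htpos |].
      pose proof (Rle_0_sqr (t - s * a)); unfold Rsqr in *; nra.
    - assert (s = 0) by nra. subst s. nra. }
  nra.
Qed.

Lemma Ssum_sq_le F n w :
  Ssum F n w * Ssum F n w <= INR n * Ssum (fun k w => F k w * F k w) n w.
Proof.
  induction n as [|n IH]; simpl Ssum; [simpl; lra|].
  rewrite S_INR. apply cauchy_schwarz_step; auto using pos_INR, Ssum_sq_nonneg.
Qed.

Lemma window_decomposition F n m w :
  Ssum (fun k => Ssum (fun j => F (k + j)%nat) m) n w =
  INR m * Ssum F n w
  + Ssum (fun j w => Ssum (fun i => F (n + i)%nat) j w - Ssum F j w) m w.
Proof.
  rewrite Ssum_swap, <- Ssum_const, <- Ssum_plus.
  apply Ssum_ext; intros j.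
  pose proof (Ssum_split F j n w) as Hjn.
  pose proof (Ssum_split F n j w) as Hnj.
  rewrite Nat.add_comm, Hnj in Hjn.
  rewrite (Ssum_ext (fun k => F (k + j)%nat) (fun k => F (j + k)%nat))
    by (intros k; rewrite Nat.add_comm; reflexivity).
  lra.
Qed.

Lemma window_bound F n m w :
  INR m * INR m * (Ssum F n w * Ssum F n w) <=
  2 * INR n * Ssum (fun k w => Ssum (fun j => F (k + j)%nat) m w *
                               Ssum (fun j => F (k + j)%nat) m w) n w
  + 4 * INR m * Ssum (fun j w => Ssum (fun i => F (n + i)%nat) j w *
                                 Ssum (fun i => F (n + i)%nat) j w
                                 + Ssum F j w * Ssum F j w) m w.
Proof.
  set (U := fun j => Ssum (fun i => F (n + i)%nat) j).
  set (D := fun j w => U j w - Ssum F j w).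
  set (A := Ssum (fun k => Ssum (fun j => F (k + j)%nat) m) n w).
  set (B := Ssum D m w).
  assert (Hdec : A = INR m * Ssum F n w + B) by apply window_decomposition.
  assert (CSwin : A * A <= INR n * Ssum (fun k w => Ssum (fun j => F (k + j)%nat) m w *
                                                    Ssum (fun j => F (k + j)%nat) m w) n w)
    by apply Ssum_sq_le.
  assert (CSbound : B * B <= INR m * Ssum (fun k w => D k w * D k w) m w)
    by apply Ssum_sq_le.
  assert (Hsq : Ssum (fun k w => D k w * D k w) m w
                <= 2 * Ssum (fun j w => U j w * U j w + Ssum F j w * Ssum F j w) m w).
  { rewrite (Ssum_mul_l (fun _ => 2)). apply Ssum_le; intros j. unfold D.
    pose proof (Rle_0_sqr (U j w + Ssum F j w)); unfold Rsqr in *; lra. }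
  assert (HmS : INR m * INR m * (Ssum F n w * Ssum F n w) <= 2 * (A * A) + 2 * (B * B)).
  { replace (INR m * INR m * (Ssum F n w * Ssum F n w)) with ((A - B) * (A - B)) by
      (rewrite Hdec; ring).
    pose proof (Rle_0_sqr (A + B)); unfold Rsqr in *; lra. }
  pose proof (pos_INR m). pose proof (pos_INR n).
  assert (HmB : INR m * Ssum (fun k w => D k w * D k w) m w <=
          INR m * (2 * Ssum (fun j w => U j w * U j w + Ssum F j w * Ssum F j w) m w))
    by (apply Rmult_le_compat_l; lra).
  lra.
Qed.

End PartialSums.

Fixpoint rsum (f : nat -> R) (n : nat) : R :=
  match n with O => 0 | S m => rsum f m + f m end.

Lemma rsum_ext f g n : (forall i, f i = g i) -> rsum f n = rsum g n.
Proof. intros H; induction n as [|n IH]; simpl; [reflexivity|]; rewrite IH, H; reflexivity. Qed.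

Lemma rsum_const c n : rsum (fun _ => c) n = INR n * c.
Proof. induction n as [|n IH]; simpl rsum; [simpl; ring|]; rewrite IH, S_INR; ring. Qed.

Lemma rsum_scal c f n : rsum (fun i => c * f i) n = c * rsum f n.
Proof. induction n as [|n IH]; simpl; [ring|]; rewrite IH; ring. Qed.

Section Expectation.
Variable P : ExpSpace.
Implicit Types (f g : Omega P -> R) (F G : nat -> Omega P -> R).

Lemma integrable_ext f g : (forall w, f w = g w) -> integrable P f -> integrable P g.
Proof. intros H; replace g with f by (apply functional_extensionality; exact H); auto. Qed.

Lemma E_ext f g : (forall w, f w = g w) -> E P f = E P g.
Proof. intros H; replace g with f by (apply functional_extensionality; exact H); auto. Qed.

Lemma E_zero : E P (fun _ => 0) = 0.
Proof.
  rewrite (E_ext _ (fun w => 0 * 1)) by (intros; ring).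
  rewrite (E_scal P 0 (fun _ => 1)) by apply integrable_const. ring.
Qed.

Lemma E_nonneg f : integrable P f -> (forall w, 0 <= f w) -> 0 <= E P f.
Proof.
  intros Hf Hpos. rewrite <- E_zero. apply E_mono; auto using integrable_const.
Qed.

Lemma integrable_Ssum F n :
  (forall i, integrable P (F i)) -> integrable P (Ssum F n).
Proof.
  intros H; induction n as [|n IH]; simpl.
  - apply (integrable_const P 0).
  - apply (integrable_plus P (Ssum F n) (F n)); auto.
Qed.

Lemma E_Ssum F n :
  (forall i, integrable P (F i)) -> E P (Ssum F n) = rsum (fun i => E P (F i)) n.
Proof.
  intros H; induction n as [|n IH]; simpl.
  - apply E_zero.
  - rewrite (E_plus P (Ssum F n) (F n)), IH; auto using integrable_Ssum.
Qed.

Lemma integrable_Ssum_prod F G a b :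
  (forall i j, integrable P (fun w => F i w * G j w)) ->
  integrable P (fun w => Ssum F a w * Ssum G b w).
Proof.
  intros H. eapply integrable_ext; [intros w; symmetry; apply Ssum_prod|].
  apply integrable_Ssum; intros i. apply integrable_Ssum; intros j. apply H.
Qed.

Lemma E_Ssum_prod F G a b :
  (forall i j, integrable P (fun w => F i w * G j w)) ->
  E P (fun w => Ssum F a w * Ssum G b w) =
  rsum (fun i => rsum (fun j => E P (fun w => F i w * G j w)) b) a.
Proof.
  intros H. rewrite (E_ext _ _ (fun w => Ssum_prod F G a b w)).
  rewrite E_Ssum by (intros i; apply integrable_Ssum; intros j; apply H).
  apply rsum_ext; intros i. apply E_Ssum. intros j; apply H.
Qed.

End Expectation.

(* One index m with a_m/m^2 < eps/(2K) suffices: if m^2 a_n <= K n^2 a_m + C for all n,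
   then a_n < eps n^2 for all large n, since C/n^2 -> 0. *)
Lemma small_ratio_propagates (a : nat -> R) (K C eps : R) (m : nat) :
  0 < K -> 0 < eps -> (1 <= m)%nat -> a m / INR m ^ 2 < eps / (2 * K) ->
  (forall n, INR m ^ 2 * a n <= K * INR n ^ 2 * a m + C) ->
  exists N, forall n, (n >= N)%nat -> a n < eps * INR n ^ 2.
Proof.
  intros HK Heps Hm Ham HC.
  set (M := INR m ^ 2) in *.
  assert (HM : 0 < M) by (apply pow_lt, lt_0_INR; lia).
  assert (HamM : K * a m < eps * M / 2).
  { apply Rmult_lt_compat_r with (r := 2 * K * M) in Ham; [|nra].
    replace (a m / M * (2 * K * M)) with (2 * (K * a m)) in Ham by (field; lra).
    replace (eps / (2 * K) * (2 * K * M)) with (eps * M) in Ham by (field; lra).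
    lra. }
  destruct (INR_unbounded (2 * Rabs C / (eps * M))) as [N HN].
  exists (Nat.max N 1). intros n Hn.
  assert (HnN : INR N <= INR n) by (apply le_INR; lia).
  assert (Hn1 : 1 <= INR n) by (change 1 with (INR 1); apply le_INR; lia).
  assert (HeM : 0 < eps * M) by nra.
  assert (Hconst : C < eps * M / 2 * INR n ^ 2).
  { assert (H2C : 2 * Rabs C < eps * M * INR n).
    { apply Rmult_lt_reg_r with (/ (eps * M)); [apply Rinv_0_lt_compat; exact HeM|].
      replace (eps * M * INR n * / (eps * M)) with (INR n) by (field; lra). lra. }
    assert (Hsq : INR n <= INR n ^ 2) by (simpl; nra).
    assert (eps * M / 2 * INR n <= eps * M / 2 * INR n ^ 2)
      by (apply Rmult_le_compat_l; lra).
    pose proof (Rle_abs C). lra. }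
  assert (Hmain : K * INR n ^ 2 * a m <= eps * M / 2 * INR n ^ 2).
  { replace (K * INR n ^ 2 * a m) with (K * a m * INR n ^ 2) by ring.
    apply Rmult_le_compat_r; [apply pow_le; lra | lra]. }
  specialize (HC n).
  apply Rmult_lt_reg_l with M; [exact HM|]. nra.
Qed.

Lemma quadratic_growth_dichotomy (a : nat -> R) (K : R) :
  0 < K -> (forall n, 0 <= a n) ->
  (forall m, (1 <= m)%nat -> exists C, forall n,
       INR m ^ 2 * a n <= K * INR n ^ 2 * a m + C) ->
  (exists eps : R, eps > 0 /\ exists N : nat, forall n : nat, (n >= N)%nat ->
       a n / INR n ^ 2 >= eps)
  \/ Un_cv (fun n => a n / INR n ^ 2) 0.
Proof.
  intros HK Hpos Hbound.
  destruct (classic (exists eps : R, eps > 0 /\ exists N : nat, forall n : nat,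
       (n >= N)%nat -> a n / INR n ^ 2 >= eps)) as [Hlow | Hnolow]; [left; exact Hlow | right].
  intros eps Heps.
  assert (Hsmall : exists m, (1 <= m)%nat /\ a m / INR m ^ 2 < eps / (2 * K)).
  { apply NNPP; intros Hno. apply Hnolow.
    exists (eps / (2 * K)); split; [apply Rdiv_lt_0_compat; lra|].
    exists 1%nat; intros n Hn. apply Rnot_lt_ge; intros Hlt. apply Hno; eauto. }
  destruct Hsmall as [m [Hm Ham]].
  destruct (Hbound m Hm) as [C HC].
  destruct (small_ratio_propagates a K C eps m HK Heps Hm Ham HC) as [N HN].
  exists (Nat.max N 1). intros n Hn.
  assert (Hn2 : 0 < INR n ^ 2) by (apply pow_lt, lt_0_INR; lia).
  unfold R_dist. rewrite Rminus_0_r, Rabs_right.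
  - apply Rmult_lt_reg_r with (INR n ^ 2); [exact Hn2|].
    unfold Rdiv; rewrite Rmult_assoc, Rinv_l, Rmult_1_r by lra. apply HN; lia.
  - apply Rle_ge, Rmult_le_pos; [apply Hpos | left; apply Rinv_0_lt_compat; exact Hn2].
Qed.

Section StationarySequence.
Variable P : ExpSpace.
Variable X : nat -> Omega P -> R.
Hypothesis Hint : forall i, integrable P (X i).
Hypothesis Hint2 : forall i j, integrable P (fun w => X i w * X j w).
Hypothesis Hcent : forall i, E P (X i) = 0.
Hypothesis Hstat : forall i k, E P (fun w => X i w * X (i + k)%nat w)
                               = E P (fun w => X 0%nat w * X k w).

Lemma cov_shift k i j :
  E P (fun w => X (k + i)%nat w * X (k + j)%nat w) = E P (fun w => X i w * X j w).
Proof.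
  assert (Hle : forall i j, (i <= j)%nat ->
            E P (fun w => X (k + i)%nat w * X (k + j)%nat w) = E P (fun w => X i w * X j w)).
  { intros i' j' Hij. replace j' with (i' + (j' - i'))%nat by lia.
    rewrite Nat.add_assoc, !Hstat. reflexivity. }
  destruct (Nat.le_gt_cases i j) as [Hij | Hji]; [now apply Hle|].
  rewrite (E_ext P _ (fun w => X (k + j)%nat w * X (k + i)%nat w)) by (intros; ring).
  rewrite (E_ext P (fun w => X i w * X j w) (fun w => X j w * X i w)) by (intros; ring).
  apply Hle; lia.
Qed.

Definition msq (n : nat) : R := E P (fun w => Ssum X n w * Ssum X n w).

Lemma msq_nonneg n : 0 <= msq n.
Proof.
  apply E_nonneg; [apply integrable_Ssum_prod; exact Hint2 | intros w; apply Rle_0_sqr].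
Qed.

Lemma Var_Ssum n : Var P (Ssum X n) = msq n.
Proof.
  unfold Var, msq. rewrite E_Ssum by exact Hint.
  rewrite (rsum_ext _ (fun _ => 0)) by exact Hcent.
  rewrite rsum_const. ring.
Qed.

Lemma msq_window k m :
  E P (fun w => Ssum (fun j => X (k + j)%nat) m w * Ssum (fun j => X (k + j)%nat) m w)
  = msq m.
Proof.
  unfold msq. rewrite !E_Ssum_prod by (intros; apply Hint2).
  apply rsum_ext; intros i. apply rsum_ext; intros j. apply cov_shift.
Qed.

Lemma msq_bound n m :
  INR m ^ 2 * msq n <= 2 * INR n ^ 2 * msq m + 8 * INR m * rsum msq m.
Proof.
  set (W := fun k w => Ssum (fun j => X (k + j)%nat) m w * Ssum (fun j => X (k + j)%nat) m w).
  set (B := fun j w => Ssum (fun i => X (n + i)%nat) j w * Ssum (fun i => X (n + i)%nat) j w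
                       + Ssum X j w * Ssum X j w).
  assert (IW : forall k, integrable P (W k)).
  { intros k; apply integrable_Ssum_prod; intros; apply Hint2. }
  assert (IB : forall j, integrable P (B j)).
  { intros j; apply integrable_plus; apply integrable_Ssum_prod; intros; apply Hint2. }
  assert (EB : forall j, E P (B j) = 2 * msq j).
  { intros j. unfold B. rewrite E_plus by (apply integrable_Ssum_prod; intros; apply Hint2).
    rewrite msq_window. unfold msq. ring. }
  assert (Hmono : E P (fun w => INR m * INR m * (Ssum X n w * Ssum X n w)) <=
                  E P (fun w => 2 * INR n * Ssum W n w + 4 * INR m * Ssum B m w)).
  { apply E_mono.
    - apply integrable_scal, integrable_Ssum_prod; exact Hint2.
    - apply integrable_plus; apply integrable_scal, integrable_Ssum; assumption.
    - intros w. apply window_bound. }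
  rewrite E_scal in Hmono by (apply integrable_Ssum_prod; exact Hint2).
  rewrite E_plus, !E_scal, !E_Ssum in Hmono
    by (try apply integrable_scal; try apply integrable_Ssum; assumption).
  rewrite (rsum_ext _ (fun _ => msq m)) in Hmono by (intros k; apply msq_window).
  rewrite (rsum_ext (fun j => E P (B j)) (fun j => 2 * msq j)), rsum_scal, rsum_const
    in Hmono by exact EB.
  fold (msq n) in Hmono. simpl. lra.
Qed.

End StationarySequence.

Theorem mainTheorem6 (P : ExpSpace) (X : nat -> Omega P -> R)
  (* real random variables with finite second moments *)
  (Hint : forall i, integrable P (X i))
  (Hint2 : forall i j, integrable P (fun w => X i w * X j w))
  (* centred *)
  (Hcent : forall i, E P (X i) = 0)
  (* weakly stationary: E[X_i X_{i+k}] depends only on k *)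
  (Hstat : forall i k, E P (fun w => X i w * X (i + k)%nat w)
                       = E P (fun w => X 0%nat w * X k w)) :
  (* liminf_n Var(S_n)/n^2 > 0 *)
  (exists eps : R, eps > 0 /\ exists N : nat, forall n : nat, (n >= N)%nat ->
       Var P (Ssum X n) / (INR n ^ 2) >= eps)
  \/
  (* Var(S_n)/n^2 -> 0 *)
  Un_cv (fun n : nat => Var P (Ssum X n) / (INR n ^ 2)) 0.
Proof.
  assert (HVar : forall n, Var P (Ssum X n) = msq P X n) by (intros; apply Var_Ssum; assumption).
  assert (Hgrowth : forall m, (1 <= m)%nat -> exists C, forall n,
             INR m ^ 2 * msq P X n <= 2 * INR n ^ 2 * msq P X m + C).
  { intros m _. exists (8 * INR m * rsum (msq P X) m). intros n.
    apply msq_bound; assumption. }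
  destruct (quadratic_growth_dichotomy (msq P X) 2) as [[eps [Heps [N HN]]] | Hcv];
    [lra | apply msq_nonneg; exact Hint2 | exact Hgrowth | left | right].
  - exists eps; split; [exact Heps|]. exists N; intros n Hn. rewrite HVar; auto.
  - intros eps Heps. destruct (Hcv eps Heps) as [N HN].
    exists N; intros n Hn. rewrite HVar; auto.
Qed.
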